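(* Let $a,b$ be positive integers and let $h_j=h^{a,b}_j$ denote the number of tilings of the honeycomb strip $H_j$ by monomers of $a$ colors and dimers of $b$ colors, with $h_0=1$ and $h_j=0$ for $j<0$. Let $F_j$ be the Fibonacci numbers ($F_0=0$, $F_1=1$, $F_{j}=F_{j-1}+F_{j-2}$). Then for every integer $n\ge 0$, $$h_{2n}-b^nF_{n+1}=a\sum_{k=0}^{n}b^k\,h_{2n-2k-1}\,F_{k+2}$$ and $$h_{2n-1}=a\sum_{k=0}^{n}b^k\,h_{2n-2k-2}\,F_{k+2}.$$
   Context: The honeycomb strip $H_n$ consists of $n$ regular hexagons arranged in two rows, numbered $1,\dots,n$ from the bottom left so that odd-numbered hexagons form the bottom row and even-numbered ones the top row; hexagon $i$ shares an edge with hexagons $i\pm1$ and $i\pm2$ (when they exist), and with no others. A monomer is a single hexagon; a dimer is a pair of edge-adjacent hexagons, i.e. either $\{i,i+1\}$ (slanted) or $\{i,i+2\}$ (horizontal). A tiling of $H_n$ is a partition of its hexagons into monomers and dimers; in a colored tiling each monomer receives one of $a$ colors and each dimer one of $b$ colors. *)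

(* Defs.v *)
From mathcomp Require Import all_boot all_order all_algebra.

Set Implicit Arguments.
Unset Strict Implicit.
Unset Printing Implicit Defensive.

(* Hexagon number i + 1 of the strip H_n is represented by i : 'I_n. *)
Definition hex_adj (n : nat) (i j : 'I_n) : bool :=
  [|| (i + 1 == j)%N, (i + 2 == j)%N, (j + 1 == i)%N | (j + 2 == i)%N].

Definition monomer (n : nat) (B : {set 'I_n}) : bool :=
  [exists i : 'I_n, B == [set i]].

Definition dimer (n : nat) (B : {set 'I_n}) : bool :=
  [exists i : 'I_n, exists j : 'I_n, hex_adj i j && (B == [set i; j])].

(* A colored tiling is a partial function on sets of hexagons: c B = None when
   B is not a tile, c B = Some (inl x) when B is a monomer of color x : 'I_a,
   and c B = Some (inr y) when B is a dimer of color y : 'I_b. *)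
Definition tiles (a b n : nat)
    (c : {ffun {set 'I_n} -> option ('I_a + 'I_b)%type}) : {set {set 'I_n}} :=
  [set B | c B != None].

Definition is_colored_tiling (a b n : nat)
    (c : {ffun {set 'I_n} -> option ('I_a + 'I_b)%type}) : bool :=
  partition (tiles c) [set: 'I_n] &&
  [forall B : {set 'I_n},
     match c B with
     | None => true
     | Some (inl _) => monomer B
     | Some (inr _) => dimer B
     end].

Definition colored_tilings (a b n : nat) :
    {set {ffun {set 'I_n} -> option ('I_a + 'I_b)%type}} :=
  [set c | is_colored_tiling c].

Definition h (a b : nat) (j : int) : nat :=
  match j with
  | Posz n => #|colored_tilings a b n|
  | Negz _ => 0
  end.

Fixpoint fib (n : nat) : nat :=
  match n with
  | 0 => 0
  | 1 => 1
  | (m.+1 as p).+1 => fib p + fib m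
  end.

Lemma h0 (a b : nat) : h a b 0%Z = 1%N.
Proof.
apply/eqP/cards1P; exists [ffun=> None]; apply/setP => c; rewrite !inE.
apply/andP/eqP => [[_ /forallP H]|->].
  apply/ffunP => B; rewrite ffunE; move: (H B); case: (c B) => //.
  by case=> ? /existsP[[]].
split; last by apply/forallP => B; rewrite ffunE.
have -> : tiles [ffun=> None] = set0 :> {set {set 'I_0}}.
  by move=> p q; apply/setP => B; rewrite !inE ffunE eqxx.
rewrite /partition /cover big_set0 inE /trivIset /cover !big_set0 cards0.
by rewrite eqxx !andbT; apply/eqP/setP => -[].
Qed.

(* Main.v *)
(** The last hexagon of the strip is a monomer, or is paired with one of its two
    predecessors; hence h_j = a h_(j-1) + b h_(j-2) + a b h_(j-3) + b^2 h_(j-4)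
    for j >= 1.  In generating functions, with y = b x^2,
      H(x) (1 - y - y^2) = 1 + a x (1 + y) H(x),
    and the coefficients of 1 / (1 - y - y^2) and (1 + y) / (1 - y - y^2) are
    the Fibonacci numbers F_(k+1) and F_(k+2).  Comparing the even and the odd
    coefficients gives the two identities; equivalently, both sides satisfy
    x_(n+2) = b x_(n+1) + b^2 x_n + a (u_(n+2) + b u_(n+1)). *)

Require Import Defs.
From mathcomp Require Import all_boot all_order all_algebra.
From mathcomp Require Import zify ring.

Set Implicit Arguments.
Unset Strict Implicit.
Unset Printing Implicit Defensive.

(** * Colored tilings of vertex sets in a finite graph *)

Section GraphTilings.
Variables (a b : nat) (T : finType) (e : rel T).

Definition coloring := {ffun {set T} -> option ('I_a + 'I_b)%type}.

Definition colored_tile (B : {set T}) (s : option ('I_a + 'I_b)%type) : bool :=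
  match s with
  | None => true
  | Some (inl _) => [exists i : T, B == [set i]]
  | Some (inr _) => [exists i : T, exists j : T, e i j && (B == [set i; j])]
  end.

Definition blocks (c : coloring) : {set {set T}} := [set B | c B != None].

(** The region [A] varies inside a fixed [T], so deleting a tile stays within the same type of
    colorings. *)
Definition tilings (A : {set T}) : {set coloring} :=
  [set c | partition (blocks c) A && [forall B, colored_tile B (c B)]].

(** Erasing the tile [B] ([del]) and putting it back with color [s] ([ins]) are mutually inverse. *)
Lemma card_tilings_with_tile (A B : {set T}) (s : 'I_a + 'I_b) :
  B != set0 -> B \subset A -> colored_tile B (Some s) ->
  #|[set c in tilings A | c B == Some s]| = #|tilings (A :\: B)|.
Proof.
move=> B0 BA okB.
pose ins (c : coloring) : coloring := [ffun X => if X == B then Some s else c X].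
pose del (c : coloring) : coloring := [ffun X => if X == B then None else c X].
(* Blocks of a tiling of [A :\: B] avoid [B], so the nonempty [B] is not one of them; this makes
   [ins] injective. *)
have notB c : c \in tilings (A :\: B) -> c B = None.
  rewrite inE => /andP[Pc _]; apply/eqP/negPn/negP => cB.
  have BP : B \in blocks c by rewrite inE.
  have := partitionS Pc BP; rewrite subsetD => /andP[_].
  by rewrite -setI_eq0 setIid (negPf B0).
rewrite -(@card_in_imset _ _ ins (tilings (A :\: B))); last first.
  move=> c1 c2 /notB c1B /notB c2B /ffunP E; apply/ffunP => X.
  by have := E X; rewrite !ffunE; case: eqP => [->|//]; rewrite c1B c2B.
congr #|pred_of_set _|; apply/setP => c; apply/idP/imsetP.
  rewrite !inE => /andP[/andP[Pc /forallP okc] /eqP cB].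
  exists (del c); last first.
    by apply/ffunP => X; rewrite !ffunE; case: eqP => [->|].
  rewrite inE.
  have -> : blocks (del c) = blocks c :\ B.
    by apply/setP => X; rewrite !inE ffunE; case: (X == B).
  rewrite partitionD1 ?inE ?cB //=.
  by apply/forallP => X; rewrite ffunE; case: eqP.
case=> c' c'T ->; rewrite !inE ffunE eqxx eqxx andbT.
have := c'T; rewrite inE => /andP[Pc /forallP okc].
apply/andP; split; last first.
  by apply/forallP => X; rewrite ffunE; case: eqP => [->|].
have -> : blocks (ins c') = B |: blocks c'.
  by apply/setP => X; rewrite !inE ffunE; case: (X == B).
have -> : A = B :|: (A :\: B).
  by apply/setP => x; rewrite !inE; have /implyP := subsetP BA x; do 2!case: (x \in _).
apply: partitionU1 => //.
by rewrite -setI_eq0; apply/eqP/setP => x; rewrite !inE; case: (x \in B).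
Qed.

Hypotheses (e_sym : symmetric e) (e_irr : irreflexive e).

(** Tilings are sorted by the tile that covers [i]: a colored monomer, or a colored dimer joining
    [i] to a neighbor in [A]. *)
Lemma card_tilings_rec (A : {set T}) (i : T) : i \in A ->
  #|tilings A| = a * #|tilings (A :\ i)|
    + b * \sum_(j in A | e i j) #|tilings (A :\: [set i; j])|.
Proof.
move=> iA.
(* An option [u] is a monomer color, or a partner of [i] with a dimer color. *)
pose tile (u : 'I_a + T * 'I_b) : {set T} :=
  match u with inl _ => [set i] | inr (j, _) => [set i; j] end.
pose color (u : 'I_a + T * 'I_b) : 'I_a + 'I_b :=
  match u with inl x => inl x | inr (_, y) => inr y end.
pose fits (u : 'I_a + T * 'I_b) :=
  match u with inl _ => true | inr (j, _) => (j \in A) && e i j end.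
have i_tile u : i \in tile u by case: u => [x|[j y]]; rewrite !inE eqxx.
(* Each tiling realizes exactly one option; counting pairs of a tiling and its option, then
   exchanging the sums, gives the recursion. *)
have one c : c \in tilings A ->
    \sum_(u | fits u) (c (tile u) == Some (color u)) = 1.
  rewrite inE => /andP[Pc /forallP okc].
  have [/eqP cov tI _] := and3P Pc.
  have [u fu cu] : exists2 u, fits u & c (tile u) = Some (color u).
    have iP : i \in cover (blocks c) by rewrite cov.
    have := pblock_mem iP; have := iP; rewrite -mem_pblock.
    move: (pblock _ _) => B iB; rewrite inE.
    have := okc B; case E: (c B) => [[x|y]|//] /existsP[k].
      by move/eqP=> EB _; exists (inl x); rewrite //= -E EB; congr (c [set _]);
        apply/eqP; move: iB; rewrite EB inE.
    case/existsP=> l /andP[ekl /eqP EB] _.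
    have BA : B \subset A by apply: (partitionS Pc); rewrite inE E.
    have [kA lA] : k \in A /\ l \in A.
      by split; apply: (subsetP BA); rewrite EB !inE eqxx ?orbT.
    move: iB; rewrite EB !inE => /orP[] /eqP Ei.
      by exists (inr (l, y)); rewrite /= Ei ?lA // -EB.
    by exists (inr (k, y)); rewrite /= Ei ?kA 1?e_sym // setUC -EB.
  rewrite (bigD1 u) //= cu eqxx big1 // => v /andP[fv nvu].
  apply/eqP; rewrite eqb0; apply: contra nvu => /eqP cv.
  (* Both tiles are blocks containing [i], hence equal; irreflexivity of [e] then lets the partner
     be read off the tile. *)
  have Euv : tile v = tile u.
    have uP : tile u \in blocks c by rewrite inE cu.
    have vP : tile v \in blocks c by rewrite inE cv.
    by rewrite -(def_pblock tI uP (i_tile u)) (def_pblock tI vP (i_tile v)).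
  move: cv; rewrite Euv cu => -[Ec]; apply/eqP.
  move: v u fv fu Euv Ec {cu} => [x|[j y]] [x'|[j' y']] //=; first by move=> _ _ _ [->].
  move=> /andP[_ eij] _ /setP/(_ j); rewrite !inE eqxx orbT => /esym/orP[/eqP Ej|/eqP -> [->] //].
  by rewrite Ej e_irr in eij.
rewrite -sum1_card (eq_bigr (fun c : coloring =>
    \sum_(u | fits u) (c (tile u) == Some (color u)))); last first.
  by move=> c /one ->.
rewrite exchange_big /= (eq_bigr (fun u => #|tilings (A :\: tile u)|)); last first.
  move=> u fu; rewrite -(@card_tilings_with_tile A (tile u) (color u)).
  - rewrite -sum1_card [RHS]big_mkcond [LHS]big_mkcond /=.
    by apply: eq_bigr => c _; rewrite !inE; case: (_ && _) => //=; case: (_ == _).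
  - by apply/set0Pn; exists i.
  - case: u fu => [x|[j y]] /= => [_|/andP[jA _]]; first by rewrite sub1set.
    by rewrite subUset !sub1set iA.
  - case: u fu => [x|[j y]] /= => [_|/andP[jA eij]]; first by apply/existsP; exists i.
    by apply/existsP; exists i; apply/existsP; exists j; rewrite eij /=.
rewrite big_sumType /= sum_nat_const card_ord; congr (_ + _).
rewrite big_distrr /=.
rewrite (eq_bigl (fun p : T * 'I_b => ((p.1 \in A) && e i p.1) && true)); last first.
  by case=> j y /=; rewrite andbT.
rewrite (eq_bigr (fun p : T * 'I_b => #|tilings (A :\: [set i; p.1])|)); last by case.
rewrite -(pair_big (fun j => (j \in A) && e i j) predT
            (fun j _ => #|tilings (A :\: [set i; j])|)) /=.
by apply: eq_bigr => j _; rewrite sum_nat_const card_ord.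
Qed.

Lemma card_tilings0 : #|tilings set0| = 1.
Proof.
apply/eqP/cards1P; exists [ffun=> None]; apply/setP => c; rewrite !inE partition_set0.
apply/andP/eqP => [[/eqP/setP Pc _]|->].
  by apply/ffunP => B; move: (Pc B); rewrite !inE ffunE; case: (c B).
split; last by apply/forallP => B; rewrite ffunE.
by apply/eqP/setP => B; rewrite !inE ffunE.
Qed.

End GraphTilings.

(* Both sides satisfy the same recursion, so no bijection between colorings is needed. *)
Lemma card_tilings_imset (a b : nat) (T T' : finType) (e : rel T) (e' : rel T')
    (f : T -> T') (A : {set T}) :
  symmetric e -> irreflexive e -> symmetric e' -> irreflexive e' ->
  injective f -> (forall x y, e' (f x) (f y) = e x y) ->
  #|tilings a b e' (f @: A)| = #|tilings a b e A|.
Proof.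
move=> es ei es' ei' f_inj ef.
have [n] := ubnP #|A|; elim: n A => // n IH A ltAn.
have fD (B : {set T}) : f @: A :\: f @: B = f @: (A :\: B).
  apply/setP => y; apply/setDP/imsetP => [[/imsetP[x xA ->] xB]|[x /setDP[xA xB] ->]].
    by exists x => //; rewrite inE xA andbT; apply: contra xB => /imset_f ->.
  by rewrite imset_f // mem_imset.
have [->|/set0Pn[i iA]] := eqVneq A set0; first by rewrite imset0 !card_tilings0.
have IHD (B : {set T}) : i \in B ->
    #|tilings a b e' (f @: A :\: f @: B)| = #|tilings a b e (A :\: B)|.
  move=> iB; rewrite fD; apply: IH; rewrite -ltnS; apply: leq_trans ltAn.
  rewrite ltnS; apply: proper_card; apply/properP; split; first exact: subsetDl.
  by exists i => //; rewrite inE iB.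
rewrite (card_tilings_rec a b es ei iA) (card_tilings_rec a b es' ei' (imset_f f iA)).
congr (_ * _ + _ * _); first by rewrite -IHD ?set11 // imset_set1.
rewrite big_mkcondr [RHS]big_mkcondr big_imset /=; last by move=> x y _ _; exact: f_inj.
apply: eq_bigr => j _; rewrite ef -IHD ?inE ?eqxx //.
by rewrite imsetU !imset_set1.
Qed.

(** * The recursion for the honeycomb strip *)

Section Strip.
Variables a b : nat.

Lemma hex_adj_sym n : symmetric (@hex_adj n).
Proof. by move=> i j; rewrite /hex_adj; lia. Qed.

Lemma hex_adj_irr n : irreflexive (@hex_adj n).
Proof. by move=> i; rewrite /hex_adj; lia. Qed.

Definition region_count (m : nat) (P : pred nat) : nat :=
  #|tilings a b (@hex_adj m) [set x : 'I_m | P x]|.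

Definition strip_count (n : nat) : nat := #|colored_tilings a b n|.

Lemma eq_region_count m (P Q : pred nat) :
  (forall x, x < m -> P x = Q x) -> region_count m P = region_count m Q.
Proof.
by move=> PQ; rewrite /region_count; congr #|pred_of_set (tilings _ _ _ _)|;
  apply/setP => x; rewrite !inE PQ.
Qed.

Lemma region_count_segment m k :
  k <= m -> region_count m (fun x => x < k) = strip_count k.
Proof.
move=> le_km.
(* For the full strip, [tilings] unfolds to [colored_tilings]. *)
have -> : strip_count k = #|tilings a b (@hex_adj k) [set: 'I_k]| by [].
rewrite -(card_tilings_imset a b (e' := @hex_adj m) (f := widen_ord le_km)) //.
- rewrite /region_count; congr #|pred_of_set (tilings _ _ _ _)|.
  apply/setP => x; rewrite inE; apply/idP/imsetP => [ltxk|[y _ ->] /=]; last exact: ltn_ord.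
  by exists (Ordinal ltxk) => //; apply: val_inj.
- exact: hex_adj_sym.
- exact: hex_adj_irr.
- exact: hex_adj_sym.
- exact: hex_adj_irr.
- by move=> x y /(congr1 val) /= E; apply: val_inj.
Qed.

(** Only [j = k - d] can contribute; the factor [d <= k] guards against truncated subtraction. *)
Lemma sum_ord_shift m k d (Q : pred nat) (F : nat -> nat) : 0 < d -> k < m ->
  \sum_(j < m) (Q j && (j + d == k)) * F j
    = ((d <= k) && Q (k - d)) * F (k - d).
Proof.
move=> d0 ltkm; have [le_dk|lt_kd] := leqP d k; last first.
  by rewrite big1 // => j _; case: eqP => [|_]; [lia | rewrite andbF].
have lt : k - d < m by lia.
rewrite (bigD1 (Ordinal lt)) //= subnK // eqxx andbT big1 ?addn0 // => j.
rewrite -val_eqE /= => nj; case: eqP => [E|_]; last by rewrite andbF.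
by rewrite -E addnK eqxx in nj.
Qed.

(** As [k] is the last hexagon of the region, its only possible partners are [k - 1] and [k - 2]. *)
Lemma region_count_rec m k (P : pred nat) :
  k < m -> P k -> (forall j, P j -> j <= k) ->
  region_count m P = a * region_count m (fun x => P x && (x != k))
    + b * (((1 <= k) && P (k - 1))
             * region_count m (fun x => [&& P x, x != k & x != k - 1])
         + ((2 <= k) && P (k - 2))
             * region_count m (fun x => [&& P x, x != k & x != k - 2])).
Proof.
move=> ltkm Pk Ple; pose i := Ordinal ltkm.
have iP : i \in [set x : 'I_m | P x] by rewrite inE.
rewrite {1}/region_count (card_tilings_rec a b (@hex_adj_sym m) (@hex_adj_irr m) iP).
congr (_ * _ + _ * _).
  congr #|pred_of_set (tilings _ _ _ _)|.
  by apply/setP => x; rewrite !inE -val_eqE andbC.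
pose F j := region_count m (fun x => [&& P x, x != k & x != j]).
rewrite -[region_count _ _]/(F (k - 1)) -[region_count _ _]/(F (k - 2)).
rewrite -!(@sum_ord_shift m k) // -big_split /= big_mkcond /=; apply: eq_bigr => j _.
rewrite inE /hex_adj /=.
have -> : #|tilings a b (@hex_adj m) ([set x | P (val x)] :\: [set i; j])| = F j.
  rewrite /F /region_count; congr #|pred_of_set (tilings _ _ _ _)|.
  by apply/setP => x; rewrite !inE -!val_eqE negb_or andbC.
rewrite -mulnDl; case Pj: (P j) => //=; have := Ple _ Pj => lejk.
by case: ifP => H; rewrite -1?[LHS]mul1n; [congr (_ * _) | rewrite (_ : _ + _ = 0)//]; lia.
Qed.

(* If the last hexagon is paired with the third from last, the hexagon left
   between them is a monomer or is paired with the fourth from last. *)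
Lemma strip_count_rec n :
  strip_count n.+1 = a * strip_count n
    + b * ((1 <= n) * strip_count (n - 1)
         + (2 <= n) * (a * strip_count (n - 2)
                       + b * ((3 <= n) * strip_count (n - 3)))).
Proof.
rewrite -(@region_count_segment n.+1 n.+1) // (@region_count_rec _ n) //.
have seg k (P : pred nat) : k <= n -> (forall x, x < n.+1 -> P x = (x < k)) ->
    region_count n.+1 P = strip_count k.
  by move=> lekn PE; rewrite (eq_region_count PE) region_count_segment // ltnW.
congr (_ * _ + _ * (_ + _)).
- by apply: seg => // x; lia.
- case: n seg => // n seg; congr (_ * _); first by rewrite /=; lia.
  by apply: seg => [|x]; lia.
case: n seg => [|[|n]] seg //; congr (_ * _); first by rewrite /=; lia.
(* With [n.+2] and [n] removed, the last hexagon is [n.+1]; its slanted partner [n] is gone, so that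
   term vanishes. *)
rewrite (@region_count_rec _ n.+1); try lia.
congr (_ * _ + _ * _); first by apply: seg => [|x]; lia.
rewrite (_ : _ && _ = false) ?mul0n ?add0n; last by lia.
case: n seg => [|n] seg //; congr (_ * _); first by rewrite /=; lia.
by apply: seg => [|x]; lia.
Qed.

End Strip.

(** * Convolutions with Fibonacci numbers and the two identities *)

Local Open Scope ring_scope.
Import GRing.Theory.

(** From [k = 2] on, the terms combine by the Fibonacci recursion. The term [k = 0] gives [u n.+2];
    the term [k = 1] is [2 * b * u n.+1], one half of which belongs to [b * conv n.+1]. *)
Lemma fib_convolution_rec (R : comPzRingType) (b : R) (u : nat -> R) (n : nat) :
  let conv m := \sum_(0 <= k < m.+1) b ^+ k * u (m - k)%N * (fib k.+2)%:R in
  conv n.+2 = b * conv n.+1 + b ^+ 2 * conv n + u n.+2 + b * u n.+1.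
Proof.
have tail : \sum_(0 <= k < n.+1) b ^+ k.+2 * u (n - k)%N * (fib k.+4)%:R
    = b * (\sum_(0 <= k < n.+1) b ^+ k.+1 * u (n - k)%N * (fib k.+3)%:R)
      + b ^+ 2 * \sum_(0 <= k < n.+1) b ^+ k * u (n - k)%N * (fib k.+2)%:R.
  rewrite !big_distrr -big_split; apply: eq_bigr => k _.
  rewrite [fib k.+4]/(fib k.+3 + fib k.+2)%N; move: (fib k.+3) (fib k.+2) => p q /=.
  by rewrite natrD !exprS; ring.
have head m (w : nat -> R) : \sum_(0 <= k < m.+2) w k * u (m.+1 - k)%N * (fib k.+2)%:R
    = w 0%N * u m.+1 + \sum_(0 <= k < m.+1) w k.+1 * u (m - k)%N * (fib k.+3)%:R.
  by rewrite big_nat_recl // subn0 [X in X + _]mulr1.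
move=> conv; rewrite /conv !head big_nat_recl //.
under eq_bigr => k _ do rewrite subSS.
rewrite tail subn0 (_ : fib 3%N = 2%N) // expr0; ring.
Qed.

(** A second-order recursion is determined by two initial values; the coefficient 2 in the second
    one is [fib 3]. *)
Lemma fib_convolution_eq (R : comPzRingType) (a b : R) (u x : nat -> R) :
  x 0%N = a * u 0%N -> x 1%N = a * (u 1%N + 2%:R * b * u 0%N) ->
  (forall n, x n.+2 = b * x n.+1 + b ^+ 2 * x n + a * (u n.+2 + b * u n.+1)) ->
  forall n, x n = a * \sum_(0 <= k < n.+1) b ^+ k * u (n - k)%N * (fib k.+2)%:R.
Proof.
move=> x0 x1 xS n.
suff: x n = a * \sum_(0 <= k < n.+1) b ^+ k * u (n - k)%N * (fib k.+2)%:R /\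
      x n.+1 = a * \sum_(0 <= k < n.+2) b ^+ k * u (n.+1 - k)%N * (fib k.+2)%:R by case.
elim: n => [|n [IH0 IH1]]; last by split=> //; rewrite xS IH0 IH1 fib_convolution_rec; ring.
by rewrite !big_nat_recr //= !big_nil x0 x1 /=; split; ring.
Qed.

Lemma h_lt0 (a b : nat) (j : int) : j < 0 -> h a b j = 0%N.
Proof. by case: j. Qed.

(** The zero values of [h] at negative indices replace the boundary factors of [strip_count_rec].
    The case [j = 0] is excluded because [h] is 1 there. *)
Lemma h_rec (a b : nat) (j : int) : 0 < j ->
  (h a b j)%:Z = a%:Z * (h a b (j - 1))%:Z + b%:Z * (h a b (j - 2))%:Z
    + a%:Z * b%:Z * (h a b (j - 3))%:Z + b%:Z ^+ 2 * (h a b (j - 4))%:Z.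
Proof.
case: j => [[|n]|] // _.
rewrite [h a b n.+1]strip_count_rec.
have hE (i : int) (k : nat) : i = k%:Z -> h a b i = strip_count a b k by move=> ->.
rewrite (hE (n.+1%:Z - 1) n); last by lia.
case: n => [|n]; first by rewrite !h_lt0 //; lia.
rewrite (hE (n.+2%:Z - 2) n); last by lia.
case: n => [|n]; first by rewrite !h_lt0 // !(mul1n, mul0n, addn0, subnn); lia.
rewrite (hE (n.+3%:Z - 3) n); last by lia.
case: n => [|n]; first by rewrite !h_lt0 // !(subSS, subn0, mul1n, mul0n, muln0, addn0); lia.
rewrite (hE (n.+4%:Z - 4) n); last by lia.
by rewrite !(subSS, subn0, mul1n); lia.
Qed.

Theorem theorem7 (a b : nat) (ha : (0 < a)%N) (hb : (0 < b)%N) (n : nat) :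
  ((h a b (2 * n%:Z))%:Z - b%:Z ^+ n * (fib n.+1)%:Z
     = a%:Z * \sum_(0 <= k < n.+1)
         b%:Z ^+ k * (h a b (2 * n%:Z - 2 * k%:Z - 1))%:Z * (fib k.+2)%:Z)
  /\
  ((h a b (2 * n%:Z - 1))%:Z
     = a%:Z * \sum_(0 <= k < n.+1)
         b%:Z ^+ k * (h a b (2 * n%:Z - 2 * k%:Z - 2))%:Z * (fib k.+2)%:Z).
Proof.
have hI (i j : int) : i = j -> h a b i = h a b j by move=> ->.
split.
- pose u m := (h a b (2 * m%:Z - 1))%:Z.
  (* The subtracted sequence solves the homogeneous recursion, so [x] keeps the recursion of the
     even terms while starting at 0, which equals [a * u 0]. *)
  pose x m := (h a b (2 * m%:Z))%:Z - b%:Z ^+ m * (fib m.+1)%:Z.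
  rewrite -/(x n) (@fib_convolution_eq _ a%:Z b%:Z u x).
  + congr (_ * _); apply: eq_big_nat => k /andP[_ lekn].
    by rewrite -(natz (fib k.+2)) /u (hI _ (2 * n%:Z - 2 * k%:Z - 1)) //; lia.
  + by rewrite /x /u h0 /=; lia.
  + rewrite /x /u h_rec // (hI (2 * 1%:Z - 2) 0) // h0.
    (* The closed integer indices are matched up to conversion. *)
    rewrite (@h_lt0 _ _ (-1)) // (@h_lt0 _ _ (-2)) //.
    by rewrite expr1 (_ : fib 2%N = 1%N) //; ring.
  + move=> m; rewrite /x /u h_rec; last by lia.
    rewrite [fib m.+3]/(fib m.+2 + fib m.+1)%N PoszD !exprS.
    rewrite (hI (2 * m.+2%:Z - 2) (2 * m.+1%:Z)); last by lia.
    rewrite (hI (2 * m.+2%:Z - 3) (2 * m.+1%:Z - 1)); last by lia.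
    rewrite (hI (2 * m.+2%:Z - 4) (2 * m%:Z)); last by lia.
    ring.
- pose u m := (h a b (2 * m%:Z - 2))%:Z.
  (* The odd terms start at index -1, where [h] is 0, so they match the convolution without a
     correction. *)
  pose x m := (h a b (2 * m%:Z - 1))%:Z.
  rewrite -/(x n) (@fib_convolution_eq _ a%:Z b%:Z u x).
  + congr (_ * _); apply: eq_big_nat => k /andP[_ lekn].
    by rewrite -(natz (fib k.+2)) /u (hI _ (2 * n%:Z - 2 * k%:Z - 2)) //; lia.
  + by rewrite /x /u /=; lia.
  + rewrite /x /u h_rec // (hI (2 * 1%:Z - 1 - 1) 0) // h0.
    rewrite (@h_lt0 _ _ (-1)) // (@h_lt0 _ _ (-2)) // (@h_lt0 _ _ (-3)) //.
    by ring.
  + move=> m; rewrite /x /u h_rec; last by lia.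
    rewrite (hI (2 * m.+2%:Z - 1 - 1) (2 * m.+2%:Z - 2)); last by lia.
    rewrite (hI (2 * m.+2%:Z - 1 - 2) (2 * m.+1%:Z - 1)); last by lia.
    rewrite (hI (2 * m.+2%:Z - 1 - 3) (2 * m.+1%:Z - 2)); last by lia.
    rewrite (hI (2 * m.+2%:Z - 1 - 4) (2 * m%:Z - 1)); last by lia.
    ring.
Qed.
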